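(* Let $\Sigma'$ be a refinement of a complete fan $\Sigma$, and let $\mathcal{E}'$ be the pull-back to $X_{\Sigma'}$ of a tropical vector bundle $\mathcal{E}$ on $X_\Sigma$. Then for every character $u\in M$, $$\chi(X_\Sigma,\mathcal{E})_u=\chi(X_{\Sigma'},\mathcal{E}')_u.$$
   Context: Let $N\cong\mathbb{Z}^n$ be a lattice with dual lattice $M$ (the character lattice), pairing $\langle\cdot,\cdot\rangle:M\times N\to\mathbb{Z}$, and $N_{\mathbb{R}}=N\otimes\mathbb{R}$. Fans consist of strictly convex rational polyhedral cones in $N_{\mathbb{R}}$; $\Sigma(1)$ is the set of rays of a fan, $\sigma(1)$ the set of rays of a cone $\sigma$, $\mathbf{v}_\rho\in N$ the primitive generator of a ray $\rho$, and $\operatorname{codim}(\sigma)=n-\dim\sigma$. Tropical vector bundle. A tropical vector bundle $\mathcal{E}$ of rank $r$ over $X_\Sigma$ ($\Sigma$ complete) consists of a matroid $\mathcal{M}$ of rank $r$ on a finite ground set $\mathcal{G}$ and, for each $\rho\in\Sigma(1)$, a decreasing filtration $(F^\rho_i)_{i\in\mathbb{Z}}$ by flats of $\mathcal{M}$, such that for each $\sigma\in\Sigma$ there are a basis $B_\sigma=\{b_{\sigma,1},\dots,b_{\sigma,r}\}$ of $\mathcal{M}$ and a multiset of characters $u(\sigma)=\{u_{\sigma,1},\dots,u_{\sigma,r}\}\subset M$ with $F^\rho_i=\operatorname{span}\{b_{\sigma,j}\mid\langle u_{\sigma,j},\mathbf{v}_\rho\rangle\ge i\}$ for all $\rho\in\sigma(1)$,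 $i\in\mathbb{Z}$. Here $\operatorname{span}$ is matroid closure. Pull-back. For a refinement $\Sigma'$ of $\Sigma$, the pull-back $\mathcal{E}'$ is the tropical vector bundle on $X_{\Sigma'}$ with the same matroid and with $B_{\sigma'}=B_\sigma$, $u(\sigma')=u(\sigma)$ whenever $\sigma'\in\Sigma'$, $\sigma\in\Sigma$, $\sigma'\subset\sigma$; that is, for a ray $\rho'\in\Sigma'(1)$ contained in $\sigma\in\Sigma$, $F'^{\rho'}_i=\operatorname{span}\{b_{\sigma,j}\mid\langle u_{\sigma,j},\mathbf{v}_{\rho'}\rangle\ge i\}$ (independent of choices). Euler characteristic. For $\sigma\in\Sigma$ and $u\in M$ let $H^0(U_\sigma,\mathcal{E}|_{U_\sigma})_u=\bigcap_{\rho\in\sigma(1)}F^\rho_{\langle u,\mathbf{v}_\rho\rangle}$, a flat of $\mathcal{M}$ (equal to $\mathcal{G}$ when $\sigma=\{0\}$). Then $\chi(X_\Sigma,\mathcal{E})_u=\sum_{\sigma\in\Sigma}(-1)^{\operatorname{codim}(\sigma)}\operatorname{rank}H^0(U_\sigma,\mathcal{E}|_{U_\sigma})_u$, and similarly for $\mathcal{E}'$ on $X_{\Sigma'}$. *)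

(* Defs.v *)
From HB Require Import structures.
From mathcomp Require Import all_boot all_order all_algebra finmap.
From mathcomp Require Import boolp classical_sets reals.

Set Implicit Arguments.
Unset Strict Implicit.
Unset Printing Implicit Defensive.

Import Order.TTheory GRing.Theory Num.Theory.

Local Open Scope ring_scope.

Record matroid (G : finType) := Matroid {
  indep : pred {set G};
  indep0 : indep finset.set0;
  indepS : forall A B : {set G}, A \subset B -> indep B -> indep A;
  indep_augment : forall A B : {set G}, indep A -> indep B ->
    (#|A| < #|B|)%N -> exists2 x, x \in B :\: A & indep (x |: A)
}.

Section MatroidTheory.
Variables (G : finType) (M : matroid G).
Implicit Types A B : {set G}.

Definition mrank A : nat := \max_(I : {set G} | indep M I && (I \subset A)) #|I|.

Definition mspan A : {set G} := [set x | mrank (x |: A) == mrank A]%SET.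

Definition is_flat A : bool := mspan A == A.

Definition is_basis B : bool := maxset (indep M) B.

End MatroidTheory.

(* N = M = 'rV[int]_n in dual bases, N_R = 'rV[R]_n. *)

Definition pairing (K : pzRingType) (n : nat) (m v : 'rV[K]_n) : K :=
  \sum_(i < n) m 0 i * v 0 i.

Section Cones.
Variables (R : realType) (n : nat).
Local Notation V := 'rV[R]_n.
Implicit Types s t rho : set V.

Definition of_lattice (v : 'rV[int]_n) : V := map_mx intr v.

Definition cone_of (k : nat) (g : 'I_k -> 'rV[int]_n) : set V :=
  [set x | exists2 c : 'I_k -> R,
     (forall i, 0 <= c i) & x = \sum_(i < k) c i *: of_lattice (g i)]%classic.

Definition rational_polyhedral s : Prop :=
  exists (k : nat) (g : 'I_k -> 'rV[int]_n), s = cone_of g.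

Definition strictly_convex s : Prop := forall x, s x -> s (- x) -> x = 0.

Definition face_of t s : Prop :=
  exists2 m : V, (forall x, s x -> 0 <= pairing m x)
               & t = [set x | s x /\ pairing m x = 0]%classic.

Definition is_lspan s (W : {vspace V}) : Prop :=
  (forall x, s x -> x \in W) /\
  (forall W' : {vspace V}, (forall x, s x -> x \in W') -> (W <= W')%VS).

Definition lspan s : {vspace V} := xget 0%VS (is_lspan s).

Lemma lspanP s : is_lspan s (lspan s).
Proof.
suff [W hW] : exists W, is_lspan s W by exact: (xgetPex _ (ex_intro _ W hW)).
pose P d := `[< exists W : {vspace V}, (forall x, s x -> x \in W) /\ \dim W = d >].
have exP : exists d, P d.
  by exists (\dim {:V}%VS); apply/asboolP; exists fullv; split=> // x _; exact: memvf.
case: (ex_minnP exP) => d /asboolP[W [sW dW]] dmin.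
exists W; split=> // W' sW'; apply/capv_idPl/eqP.
rewrite eqEdim capvSl dW; apply: dmin; apply/asboolP; exists (W :&: W')%VS.
by split=> // x sx; rewrite memv_cap sW ?sW'.
Qed.

Definition cone_dim s : nat := \dim (lspan s).

Definition is_ray s rho : Prop := face_of rho s /\ cone_dim rho = 1%N.

(* the case k = 0 rules out v = 0 *)
Definition primitive (v : 'rV[int]_n) : Prop :=
  forall (k : nat) (w : 'rV[int]_n), v = w *+ k -> k = 1%N.

Definition ray_gen rho : 'rV[int]_n :=
  xget 0 [set v | primitive v /\ rho = cone_of (fun _ : 'I_1 => v)]%classic.

Record fan := Fan {
  cones : {fset (set V)};
  fan_neq0 : cones != fset0;
  fan_polyhedral : forall s, s \in cones -> rational_polyhedral s;
  fan_strictly_convex : forall s, s \in cones -> strictly_convex s;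
  fan_face : forall s t, s \in cones -> face_of t s -> t \in cones;
  fan_meet : forall s t, s \in cones -> t \in cones ->
    face_of (s `&` t)%classic s /\ face_of (s `&` t)%classic t
}.

Definition support (S : fan) : set V :=
  [set x | exists2 s, s \in cones S & s x]%classic.

Definition complete_fan (S : fan) : Prop := support S = setT.

Definition refines (S' S : fan) : Prop :=
  support S' = support S /\
  forall s', s' \in cones S' -> exists2 s, s \in cones S & (s' `<=` s)%classic.

Definition fan_ray (S : fan) rho : Prop := rho \in cones S /\ cone_dim rho = 1%N.

End Cones.

Section Bundles.
Variables (R : realType) (n : nat) (G : finType) (M : matroid G).
Local Notation V := 'rV[R]_n.

(* The multiset u(s) is indexed by the basis B: the character attached to
   b \in B is [ch b]; values of [ch] outside B play no role. *)
Definition splits (F : set V -> int -> {set G}) (s : set V)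
    (B : {set G}) (ch : G -> 'rV[int]_n) : Prop :=
  is_basis M B /\
  forall rho, is_ray s rho -> forall i : int,
    F rho i = mspan M [set b in B | i <= pairing (ch b) (ray_gen rho)]%SET.

(* Only the values of [filt] at the rays of the fan are meaningful. *)
Record tropical_bundle (S : fan R n) := TropicalBundle {
  filt : set V -> int -> {set G};
  filt_flat : forall rho, fan_ray S rho -> forall i, is_flat M (filt rho i);
  filt_decreasing : forall rho, fan_ray S rho ->
    forall i j : int, i <= j -> filt rho j \subset filt rho i;
  filt_splits : forall s, s \in cones S -> exists B ch, splits filt s B ch
}.

Definition is_pullback (S S' : fan R n)
    (E : tropical_bundle S) (E' : tropical_bundle S') : Prop :=
  exists (B : set V -> {set G}) (ch : set V -> G -> 'rV[int]_n),
    (forall s, s \in cones S -> splits (filt E) s (B s) (ch s)) /\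
    (forall s s', s \in cones S -> s' \in cones S' -> (s' `<=` s)%classic ->
       splits (filt E') s' (B s) (ch s)).

(* the degree-u part of H^0(U_s, E): intersection of flats over the rays of s *)
Definition H0 (S : fan R n) (E : tropical_bundle S) (s : set V)
    (u : 'rV[int]_n) : {set G} :=
  [set g | `[< forall rho, is_ray s rho ->
                 g \in filt E rho (pairing u (ray_gen rho)) >]]%SET.

Definition euler_char (S : fan R n) (E : tropical_bundle S)
    (u : 'rV[int]_n) : int :=
  \sum_(s <- cones S) (-1) ^+ (n - cone_dim s) * (mrank M (H0 E s u))%:Z.

End Bundles.

(* Main.v *)
(* A flat [H0 E s u] is spanned by the basis elements [b] of [B_s] whose
   functional [m_b = u_b - u] is nonnegative on [s], because an intersection of
   spans of subsets of a basis is spanned by their intersection, and [s] is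
   generated by its rays.  Write [chi] for the compactly supported Euler
   characteristic, with [chi C = (-1)^(dim C)] for a relatively open convex cone.
   For every cone [s] and functional [m], [chi (relint s `&` {m >= 0})] equals
   [(-1)^(dim s)] if [m >= 0] on [s] and [0] otherwise.  So the contribution
   of [s] to the Euler characteristic is, up to sign, the sum over [b] of
   [chi (relint s `&` {m_b >= 0})], and since [relint s] is the disjoint union
   of the relative interiors of the cones of the refinement that it meets, on
   all of which the pull-back uses the same basis and characters, additivity of
   [chi] concludes.
   Additivity is elementary: [chi] is additive under cutting by a hyperplane, and
   disjoint relatively open polyhedral cones are separated by hyperplanes, so one
   can induct on the number of pieces. *)

From HB Require Import structures.
Require Import Defs.
From mathcomp Require Import all_boot all_order all_algebra finmap.
From mathcomp Require Import boolp classical_sets reals.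
From mathcomp Require Import ring lra.

Set Implicit Arguments.
Unset Strict Implicit.
Unset Printing Implicit Defensive.

Import Order.TTheory GRing.Theory Num.Theory.

Local Open Scope ring_scope.

(** * Cones and Farkas' lemma *)

Section Pairing.
Variables (K : comPzRingType) (n : nat).
Implicit Types m x y : 'rV[K]_n.

Lemma pairingC m x : pairing m x = pairing x m.
Proof. by apply: eq_bigr => i _; rewrite mulrC. Qed.

Lemma pairingDr m x y : pairing m (x + y) = pairing m x + pairing m y.
Proof. by rewrite -big_split; apply: eq_bigr => i _; rewrite mxE mulrDr. Qed.

Lemma pairingZr a m x : pairing m (a *: x) = a * pairing m x.
Proof. by rewrite mulr_sumr; apply: eq_bigr => i _; rewrite mxE mulrCA. Qed.

Lemma pairing0r m : pairing m 0 = 0.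
Proof. by rewrite -(scale0r 0) pairingZr mul0r. Qed.

Lemma pairingNr m x : pairing m (- x) = - pairing m x.
Proof. by rewrite -scaleN1r pairingZr mulN1r. Qed.

Lemma pairingBr m x y : pairing m (x - y) = pairing m x - pairing m y.
Proof. by rewrite pairingDr pairingNr. Qed.

Lemma pairingDl m x y : pairing (m + x) y = pairing m y + pairing x y.
Proof. by rewrite !(pairingC _ y) pairingDr. Qed.

Lemma pairingZl a m y : pairing (a *: m) y = a * pairing m y.
Proof. by rewrite !(pairingC _ y) pairingZr. Qed.

Lemma pairingNl m y : pairing (- m) y = - pairing m y.
Proof. by rewrite !(pairingC _ y) pairingNr. Qed.

Lemma pairingBl m x y : pairing (m - x) y = pairing m y - pairing x y.
Proof. by rewrite pairingDl pairingNl. Qed.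

Lemma pairing0l m : pairing 0 m = 0.
Proof. by rewrite pairingC pairing0r. Qed.

End Pairing.

Definition pairingE := (pairingDr, pairingZr, pairingNr, pairing0r,
  pairingDl, pairingZl, pairingNl, pairing0l).

Lemma pairing_of_lattice (R : realType) (n : nat) (m v : 'rV[int]_n) :
  pairing (of_lattice R m) (of_lattice R v) = (pairing m v)%:~R.
Proof.
by rewrite /pairing rmorph_sum; apply: eq_bigr => i _; rewrite !mxE rmorphM.
Qed.

Section ConvexCones.
Variables (R : realType) (n : nat).
Local Notation V := 'rV[R]_n.
Implicit Types (m f x y z g : V) (gs : seq V) (s t C K : set V).

Lemma pairing_self_le0 x : pairing x x <= 0 -> x = 0.
Proof.
move=> x_le0; have sq i : 0 <= x 0 i * x 0 i by rewrite -expr2 sqr_ge0.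
have /eqP : pairing x x = 0 by apply: le_anti; rewrite x_le0 sumr_ge0.
rewrite psumr_eq0 // => /allP x0; apply/rowP => i; rewrite mxE.
by have := x0 i (mem_index_enum _); rewrite mulf_eq0 orbb => /eqP.
Qed.

Definition convex_cone K : Prop :=
  [/\ K 0, forall x y, K x -> K y -> K (x + y)
    & forall a x, 0 <= a -> K x -> K (a *: x)].

(** The impredicative form makes induction on membership an instance of the definition and avoids
    families of coefficients. *)
Definition conic gs : set V :=
  fun x => forall K, convex_cone K -> (forall g, g \in gs -> K g) -> K x.

Lemma conic_convex gs : convex_cone (conic gs).
Proof.
split=> [K [] // | x y cx cy K hK hgs | a x a0 cx K hK hgs].
  by case: (hK) => _ KD _; apply: KD; [apply: cx | apply: cy].
by case: (hK) => _ _ KZ; apply: KZ => //; apply: cx.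
Qed.

Lemma mem_conic gs g : g \in gs -> conic gs g.
Proof. by move=> gs_g K _; apply. Qed.

Lemma conic_ind gs (P : V -> Prop) :
  P 0 -> (forall x y, P x -> P y -> P (x + y)) ->
  (forall a x, 0 <= a -> P x -> P (a *: x)) -> (forall g, g \in gs -> P g) ->
  forall x, conic gs x -> P x.
Proof. by move=> P0 PD PZ Pgs x; apply. Qed.

Lemma conic_sub gs gs' x :
  (forall g, g \in gs -> conic gs' g) -> conic gs x -> conic gs' x.
Proof. by move=> sub; apply=> //; apply: conic_convex. Qed.

(** Extracts the coefficient of one generator; used when Farkas' lemma is applied to a list enlarged
    by an extra vector such as [- x]. *)
Lemma conic_cons g gs x : conic (g :: gs) x ->
  exists2 c : R, 0 <= c & conic gs (x - c *: g).
Proof.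
have [c0 cD cZ] := conic_convex gs.
move: x; apply: conic_ind.
- by exists 0; rewrite // scale0r subr0.
- move=> y z [a a0 ay] [b b0 bz]; exists (a + b); first exact: addr_ge0.
  by rewrite scalerDl opprD addrACA; apply: cD.
- move=> a y a0 [b b0 cy]; exists (a * b); first exact: mulr_ge0.
  by rewrite -scalerA -scalerBr; apply: cZ.
- move=> h; rewrite inE => /predU1P[->|h_gs].
    by exists 1; rewrite // scale1r subrr.
  by exists 0; rewrite // scale0r subr0; apply: mem_conic.
Qed.

Lemma conic_halfspace gs m : (forall g, g \in gs -> 0 <= pairing m g) ->
  forall x, conic gs x -> 0 <= pairing m x.
Proof.
move=> m_gs; apply: conic_ind => // [|x y mx my|a x a0 mx]; rewrite pairingE //.
  exact: addr_ge0.
exact: mulr_ge0.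
Qed.

(* Bartl's proof: if the generator [g] cannot be dropped, some functional [y]
   is nonnegative on the others but negative on [g]; project along [g]
   onto the kernel of [y]. *)
Theorem farkas gs v :
  (forall m, (forall g, g \in gs -> 0 <= pairing m g) -> 0 <= pairing m v) ->
  conic gs v.
Proof.
(* The induction is on the length because it is also applied to the projected list [map proj gs]. *)
elim: {gs}(size gs) {-2}gs (erefl (size gs)) v => [|k IH] [|g gs] //= sz v hv.
  suff -> : v = 0 by case: (conic_convex [::]).
  (* Without generators every functional is admissible; the choice [- v] forces [v = 0]. *)
  by apply: pairing_self_le0; rewrite -oppr_ge0 -pairingNl; apply: hv.
case: sz => sz.
have [drop|] := pselect (forall m, (forall h, h \in gs -> 0 <= pairing m h) ->
                              0 <= pairing m v).
  apply: (conic_sub _ (IH gs sz v drop)) => h h_gs.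
  by apply: mem_conic; rewrite inE h_gs orbT.
move=> /existsNP[y /not_implyP[y_gs /negP]]; rewrite -ltNge => yv.
have yg : pairing y g < 0.
  rewrite ltNge; apply/negP => yg; move: yv; rewrite ltNge => /negP; apply.
  by apply: hv => h; rewrite inE => /predU1P[->|/y_gs].
pose proj x := x - (pairing y x / pairing y g) *: g.
have projP : conic (map proj gs) (proj v).
  apply: IH => [|x hx]; first by rewrite size_map.
  (* [z] is the image of [x] under the adjoint of [proj], so it vanishes on [g]. *)
  pose z := x - (pairing x g / pairing y g) *: y.
  have zE w : pairing z w = pairing x (proj w).
    by rewrite /z /proj !pairingE (pairingC y w) mulrAC -mulrA mulrC mulrAC.
  rewrite -zE; apply: hv => h; rewrite inE => /predU1P[->|h_gs].
    by rewrite /z !pairingE mulfVK ?lt_eqF // subrr.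
  by rewrite zE; apply: hx; apply: map_f.
have [w cw vE] : exists2 w, conic gs w & proj v = proj w.
  have [c0 cD cZ] := conic_convex gs.
  move: (proj v) projP; apply: conic_ind.
  - by exists 0 => //; rewrite /proj pairing0r mul0r scale0r subr0.
  - move=> a b [a' ca ->] [b' cb ->]; exists (a' + b'); first exact: cD.
    by rewrite /proj pairingDr mulrDl scalerDl opprD addrACA.
  - move=> a b a0 [b' cb ->]; exists (a *: b'); first exact: cZ.
    by rewrite /proj pairingZr -mulrA scalerBr scalerA.
  - by move=> _ /mapP[h h_gs ->]; exists h => //; apply: mem_conic.
have yw : 0 <= pairing y w by apply: (conic_halfspace y_gs).
(* The coefficient of [g] is nonnegative, since [y] is negative on [v] and [g] but nonnegative on
   [w]. *)
have -> : v = w + ((pairing y v - pairing y w) / pairing y g) *: g.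
  rewrite mulrBl scalerBl addrCA -/(proj w) -vE /proj addrC subrK //.
have [_ cD cZ] := conic_convex (g :: gs).
apply: cD.
  by apply: conic_sub cw => h h_gs; apply: mem_conic; rewrite inE h_gs orbT.
apply: cZ; last by apply: mem_conic; rewrite mem_head.
by rewrite mulr_le0 ?invr_le0 ?(ltW yg) // subr_le0 (le_trans (ltW yv)).
Qed.

Lemma farkas_sep gs v : ~ conic gs v ->
  exists2 m, (forall x, conic gs x -> 0 <= pairing m x) & pairing m v < 0.
Proof.
move=> ncv; apply: contrapT => nsep; apply: ncv; apply: farkas => m hm.
rewrite leNgt; apply/negP => mv; apply: nsep; exists m => // x.
exact: conic_halfspace.
Qed.

(** The algebraic form of the relative interior of a convex cone: one can move a little from [x]
    away from any point of [s]. No topology is involved. *)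
Definition relint s : set V :=
  fun x => s x /\ forall y, s y -> exists2 e : R, 0 < e & s (x - e *: y).

(** The third condition makes a nonempty [C] open in its linear span. The empty set is allowed, so
    that cutting by a hyperplane stays within this class. *)
Definition rel_open C : Prop :=
  [/\ forall x y, C x -> C y -> C (x + y),
      forall a x, 0 < a -> C x -> C (a *: x)
    & forall x y, C x -> C y -> exists2 e : R, 0 < e & C (x - e *: y)].

Lemma relintDr s x y : convex_cone s -> relint s x -> s y -> relint s (x + y).
Proof.
case=> _ sD _ [sx rx] sy; split=> [|z /rx[e e0 sz]]; first exact: sD.
by exists e; rewrite // addrAC; apply: sD.
Qed.

Lemma relintZ s a x : convex_cone s -> 0 < a -> relint s x -> relint s (a *: x).
Proof.
case=> _ _ sZ a0 [sx rx]; split=> [|z /rx[e e0 sz]]; first exact: sZ (ltW a0) _.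
by exists (a * e); rewrite ?mulr_gt0 // -scalerA -scalerBr; apply: sZ (ltW a0) _.
Qed.

Lemma relint_open s : convex_cone s -> rel_open (relint s).
Proof.
move=> hs; have [_ sD sZ] := hs; split=> [x y rx [sy _]|a x a0 rx|x y rx [sy _]].
- exact: relintDr.
- exact: relintZ.
- have [e e0 sxy] := rx.2 y sy; exists (e / 2); first by rewrite divr_gt0.
  (* Halving [e] leaves a summand [x / 2] in the relative interior, which absorbs the other summand
     from [s]. *)
  have -> : x - (e / 2) *: y = 2^-1 *: x + 2^-1 *: (x - e *: y).
    rewrite scalerBr scalerA addrA -scalerDl -mulr2n -(mulr_natr 2^-1) mulVf ?pnatr_eq0 //.
    by rewrite scale1r mulrC.
  by apply: relintDr; [|apply: relintZ|apply: sZ];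
    rewrite // ?invr_ge0 ?invr_gt0.
Qed.

(** Since [m] is nonnegative at [x - e *: y], its value at [x] is at least [e] times its value at
    [y]. *)
Lemma relint_pairing_gt0 s m x y : (forall z, s z -> 0 <= pairing m z) ->
  relint s x -> s y -> pairing m y != 0 -> 0 < pairing m x.
Proof.
move=> ms [sx rx] sy my; have [e e0 /ms] := rx y sy.
rewrite pairingBr pairingZr subr_ge0; apply: lt_le_trans.
by rewrite mulr_gt0 // lt0r my ms.
Qed.

(** The vectors of which some positive multiple can be subtracted form a convex cone containing
    every generator. This supplies an explicit interior point, also for the zero cone. *)
Lemma relint_conic gs : relint (conic gs) (\sum_(g <- gs) g).
Proof.
have [c0 cD cZ] := conic_convex gs.
have sumP : conic gs (\sum_(g <- gs) g).
  by rewrite big_seq; elim/big_ind: _ => //; apply: mem_conic.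
split=> //; apply: conic_ind.
- by exists 1; rewrite // scaler0 subr0.
- move=> a b [e e0 ha] [d d0 hb].
  exists ((e^-1 + d^-1)^-1); first by rewrite invr_gt0 addr_gt0 ?invr_gt0.
  set w := \sum_(g <- gs) g in ha hb *.
  have ed : 0 < e^-1 + d^-1 by rewrite addr_gt0 ?invr_gt0.
  (* A convex combination of [w - e *: a] and [w - d *: b], with weights proportional to [e^-1] and
     [d^-1] so that [a] and [b] get equal coefficients. *)
  have -> : w - (e^-1 + d^-1)^-1 *: (a + b) = (e^-1 + d^-1)^-1 *:
      (e^-1 *: (w - e *: a) + d^-1 *: (w - d *: b)).
    rewrite !scalerBr !scalerA !mulVf ?gt_eqF // !scale1r addrACA -scalerDl.
    by rewrite -opprD scalerBr scalerA mulVf ?gt_eqF // scale1r.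
  by apply: (cZ); [|apply: cD; apply: (cZ)]; rewrite // invr_ge0 ltW.
- move=> a b a0 [e e0 hb]; have [->|a_neq0] := eqVneq a 0.
    by exists 1; rewrite // scale0r scaler0 subr0.
  exists (e / a); first by rewrite divr_gt0 // lt0r a_neq0.
  by rewrite scalerA mulfVK.
- move=> g g_gs; exists 1; rewrite // scale1r.
  rewrite (perm_big _ (perm_to_rem g_gs)) big_cons addrC addKr.
  rewrite big_seq; elim/big_ind: _ => // h /mem_rem; exact: mem_conic.
Qed.

(** Strictness on one side ensures that the hyperplane [f = 0] misses one of the two sets. *)
Definition separated C D : Prop := exists f,
  [/\ forall x, C x -> 0 <= pairing f x, forall x, D x -> pairing f x <= 0
    & (forall x, C x -> 0 < pairing f x) \/ (forall x, D x -> pairing f x < 0)].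

(* Farkas on the difference of the two cones: if no functional separates them,
   that difference contains the opposite of [sum gs - sum hs], which yields a
   common relative interior point. *)
Lemma relint_separated gs hs :
  (forall x, relint (conic gs) x -> ~ relint (conic hs) x) ->
  separated (relint (conic gs)) (relint (conic hs)).
Proof.
move=> disj; pose w := \sum_(g <- gs) g; pose w' := \sum_(h <- hs) h.
pose ks := gs ++ map -%R hs.
have [c0 cD cZ] := conic_convex ks.
have [h0 hD hZ] := conic_convex hs; have [g0 gD gZ] := conic_convex gs.
have [|f fks fw] := @farkas_sep ks (w' - w).
  move=> cw; have [a [b [ca cb]]] : exists a b,
      [/\ conic gs a, conic hs b & w' - w = a - b].
    move: (w' - w) cw; apply: conic_ind.
    - by exists 0, 0; rewrite subrr.
    - move=> _ _ [a [b [ca cb ->]]] [a' [b' [ca' cb' ->]]].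
      by exists (a + a'), (b + b'); split; rewrite ?opprD 1?addrACA //; auto.
    - move=> c _ c0' [a [b [ca cb ->]]].
      by exists (c *: a), (c *: b); split; rewrite ?scalerBr //; auto.
    - move=> g; rewrite mem_cat => /orP[g_gs|/mapP[h h_hs ->]].
        by exists g, 0; rewrite subr0; split=> //; apply: mem_conic.
      by exists 0, h; rewrite sub0r; split=> //; apply: mem_conic.
  move=> E; apply: (disj (w + a)).
    by apply: relintDr; [exact: conic_convex|exact: relint_conic|].
  have -> : w + a = w' + b.
    by apply/eqP; rewrite -subr_eq0 opprD addrACA -E -(opprB w w') subrr.
  by apply: relintDr; [exact: conic_convex|exact: relint_conic|].
have fg x : conic gs x -> 0 <= pairing f x.
  move=> cx; apply: fks; apply: conic_sub cx => g g_gs.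
  by apply: mem_conic; rewrite mem_cat g_gs.
have fh x : conic hs x -> 0 <= pairing (- f) x.
  move: x; apply: conic_halfspace => h h_hs; rewrite pairingNl -pairingNr.
  by apply: fks; apply: mem_conic; rewrite mem_cat map_f ?orbT.
exists f; split=> [x [/fg//]|x [/fh]|]; first by rewrite pairingNl oppr_ge0.
(* As [f] is smaller at [w'] than at [w], it is positive at [w] or negative at [w']; one nonzero
   value on a cone gives strictness on its whole relative interior. *)
have [fw0|fw0] := eqVneq (pairing f w) 0.
  right=> x rx; rewrite -oppr_gt0 -pairingNl.
  apply: (relint_pairing_gt0 fh rx (relint_conic hs).1).
  by rewrite pairingNl oppr_eq0; move: fw; rewrite pairingBr fw0 subr0 => /lt_eqF->.
by left=> x rx; apply: (relint_pairing_gt0 fg rx (relint_conic gs).1).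
Qed.

End ConvexCones.

(** * Euler characteristics of relatively open cones *)

Section EulerMeasure.
Variables (R : realType) (n : nat).
Local Notation V := 'rV[R]_n.
Implicit Types (m f x y z : V) (s t C D : set V) (W : {vspace V}).

Lemma mem_lspan s x : s x -> x \in lspan s.
Proof. exact: (lspanP s).1. Qed.

Lemma lspan_sub s W : (forall x, s x -> x \in W) -> (lspan s <= W)%VS.
Proof. exact: (lspanP s).2. Qed.

Lemma lspan_ext s t : (forall x, s x -> t x) -> (forall x, t x -> x \in lspan s) ->
  lspan s = lspan t.
Proof.
move=> st ts; apply/eqP; rewrite eqEsubv (lspan_sub ts) andbT.
by apply: lspan_sub => x /st; apply: mem_lspan.
Qed.

Lemma lspan_kernel s W m x : (forall y, s y -> pairing m y = 0) ->
  x \in lspan s -> pairing m x = 0.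
Proof.
move=> ms; pose phi : V -> R^o := pairing m.
have phi_lin : linear phi by move=> a y z; rewrite /phi !pairingE.
pose phiL : {linear V -> R^o} := HB.pack phi (GRing.isLinear.Build _ _ _ _ phi phi_lin).
have sub : (lspan s <= lker (linfun phiL))%VS.
  by apply: lspan_sub => y sy; rewrite memv_ker lfunE; apply/eqP/ms.
by move=> /(subvP sub); rewrite memv_ker lfunE => /eqP.
Qed.

Definition pos_part C f : set V := fun x => C x /\ 0 < pairing f x.
Definition null_part C f : set V := fun x => C x /\ pairing f x = 0.

Lemma pos_part_open C f : rel_open C -> rel_open (pos_part C f).
Proof.
case=> CD CZ CB; split=> [x y [Cx fx] [Cy fy]|a x a0 [Cx fx]|x y [Cx fx] [Cy fy]].
- by split; [exact: CD | rewrite pairingE addr_gt0].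
- by split; [exact: CZ | rewrite pairingE mulr_gt0].
- have [e e0 Cxy] := CB x y Cx Cy.
  (* The first bound keeps the point in [C], the second keeps [f] positive; halving makes both
     strict. *)
  pose d := Num.min e (pairing f x / pairing f y) / 2.
  have m0 : 0 < Num.min e (pairing f x / pairing f y) by rewrite lt_min e0 divr_gt0.
  have lt_d : d < Num.min e (pairing f x / pairing f y) by rewrite /d; lra.
  exists d; first by rewrite /d divr_gt0.
  move: lt_d; rewrite lt_min => /andP[de dfy]; split.
    have -> : x - d *: y = x - e *: y + (e - d) *: y.
      by rewrite scalerBl addrA subrK.
    by apply: CD => //; apply: CZ; rewrite ?subr_gt0.
  by rewrite !pairingE subr_gt0 -ltr_pdivlMr.
Qed.

Lemma null_part_open C f : rel_open C -> rel_open (null_part C f).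
Proof.
case=> CD CZ CB; split=> [x y [Cx fx] [Cy fy]|a x a0 [Cx fx]|x y [Cx fx] [Cy fy]].
- by split; [exact: CD | rewrite pairingE fx fy addr0].
- by split; [exact: CZ | rewrite pairingE fx mulr0].
- have [e e0 Cxy] := CB x y Cx Cy; exists e => //; split=> //.
  by rewrite !pairingE fx fy mulr0 subr0.
Qed.

(* The compactly supported Euler characteristic of a relatively open cone. *)
Definition eul C : int := if `[< exists x, C x >] then (-1) ^+ cone_dim C else 0.

Lemma eul_neq0 C x : C x -> eul C = (-1) ^+ cone_dim C.
Proof. by move=> Cx; rewrite /eul asboolT //; exists x. Qed.

Lemma eul0 C : (forall x, ~ C x) -> eul C = 0.
Proof. by move=> C0; rewrite /eul asboolF // => -[x /C0]. Qed.

Lemma eq_eul C D : (forall x, C x <-> D x) -> eul C = eul D.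
Proof. by move=> CD; congr eul; apply/funext => x; apply/propext. Qed.

(** For small [e > 0] the point [x + e *: z] stays on the positive side, and [z] is a multiple of
    its difference with [x]. *)
Lemma lspan_pos_part C f x : rel_open C -> pos_part C f x ->
  lspan (pos_part C f) = lspan C.
Proof.
move=> oC Cfx; have [CD CZ CB] := oC; apply: lspan_ext => [y []//|z Cz].
have [Cx fx] := Cfx; set P := pos_part C f.
have [e e0 Pxz] : exists2 e : R, 0 < e & P (x + e *: z).
  exists (pairing f x / (2 * (`|pairing f z| + 1))).
    by rewrite divr_gt0 ?mulr_gt0 // ltr_wpDl.
  have b0 : 0 < `|pairing f z| + 1 by rewrite ltr_wpDl.
  set e := _ / _; have e0 : 0 < e by rewrite divr_gt0 ?mulr_gt0.
  split; first by apply: CD => //; apply: CZ.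
  rewrite !pairingE; have : - (e * pairing f z) < pairing f x.
    rewrite -mulrN; apply: le_lt_trans (_ : e * (`|pairing f z| + 1) < _).
      rewrite ler_pM2l //; have := ler_norm (- pairing f z); rewrite normrN.
      by move/le_trans; apply; rewrite lerDl.
    rewrite /e invfM mulrA mulfVK ?gt_eqF //.
    by rewrite ltr_pdivrMr //; lra.
  by rewrite -subr_gt0 opprK.
have -> : z = e^-1 *: (x + e *: z - x) by rewrite addrC addKr scalerA mulVf ?gt_eqF // scale1r.
by apply/memvZ/memvB; apply: mem_lspan.
Qed.

(** The span of [C] is the direct sum of the span of the null part and the line of [x]: any point of
    [C] reaches the hyperplane after adding a multiple of [x] or [y], whichever lies on the opposite
    side. *)
Lemma cone_dim_null_part C f x y : rel_open C ->
  C x -> 0 < pairing f x -> C y -> pairing f y < 0 ->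
  (exists z, null_part C f z) /\ cone_dim C = (cone_dim (null_part C f)).+1.
Proof.
case=> CD CZ CB Cx fx Cy fy; set C0 := null_part C f.
have mixP a b z w : 0 < a -> 0 < b -> C z -> C w ->
    a * pairing f z + b * pairing f w = 0 -> C0 (a *: z + b *: w).
  by move=> a0 b0 Cz Cw E; split; rewrite ?pairingE //; apply: CD; apply: CZ.
have Nfy : 0 < - pairing f y by rewrite oppr_gt0.
pose p := (- pairing f y) *: x + pairing f x *: y.
have C0p : C0 p by apply: mixP => //; ring.
split; first by exists p.
have xNC0 : x \notin lspan C0.
  apply: contraL fx => xC0; rewrite -leNgt.
  by rewrite (lspan_kernel 0%VS _ xC0) // => w [].
have y_in : y \in (lspan C0 + <[x]>)%VS.
  have -> : y = (pairing f x)^-1 *: p + (pairing f y / pairing f x) *: x.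
    rewrite /p scalerDr !scalerA mulVf ?gt_eqF // scale1r addrAC -scalerDl.
    by rewrite mulrN mulrC addNr scale0r add0r.
  by apply: memv_add; [apply/memvZ/mem_lspan | apply/memvZ/memv_line].
suff -> : cone_dim C = \dim (lspan C0 + <[x]>).
  rewrite dimv_disjoint_sum ?dim_vline; last first.
    apply/eqP; rewrite -subv0; apply/subvP => w; rewrite memv_cap.
    case/andP=> wC0 /vlineP[k wE]; rewrite memv0 wE; apply: contraNT xNC0 => kx.
    have k0 : k != 0 by apply: contraNneq kx => ->; rewrite scale0r.
    have -> : x = k^-1 *: w by rewrite wE scalerA mulVf // scale1r.
    exact: memvZ.
  suff -> : x != 0 by rewrite addn1.
  by apply: contraTneq fx => ->; rewrite pairing0r ltxx.
rewrite /cone_dim; congr (\dim _); apply/eqP; rewrite eqEsubv; apply/andP; split.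
  apply: lspan_sub => z Cz; have C0_sub w : C0 w -> w \in (lspan C0 + <[x]>)%VS.
    by move/mem_lspan; apply/subvP/addvSl.
  have [fz|fz|fz] := ltgtP (pairing f z) 0; last exact: C0_sub.
  - have /C0_sub C0z : C0 (pairing f x *: z + (- pairing f z) *: x).
      by apply: mixP; rewrite ?oppr_gt0 //; ring.
    have -> : z = (pairing f x)^-1 *:
        (pairing f x *: z + (- pairing f z) *: x + pairing f z *: x).
      by rewrite scaleNr subrK scalerA mulVf ?gt_eqF // scale1r.
    apply/memvZ/memvD => //; apply/memvZ; apply: (subvP (addvSr _ _)).
    exact: memv_line.
  - have /C0_sub C0z : C0 ((- pairing f y) *: z + pairing f z *: y).
      by apply: mixP => //; ring.
    have -> : z = (- pairing f y)^-1 *: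
        ((- pairing f y) *: z + pairing f z *: y - pairing f z *: y).
      by rewrite addrK scalerA mulVf ?gt_eqF // scale1r.
    by apply/memvZ/memvB => //; apply/memvZ.
rewrite subv_add; apply/andP; split; first by apply: lspan_sub => w [Cw _]; apply: mem_lspan.
by rewrite -memvE mem_lspan.
Qed.

(* If both open sides of the cut are nonempty, the three terms have the
   dimensions [d], [d - 1] and [d] with [d = cone_dim C]. *)
Lemma eul_cut C f : rel_open C ->
  eul C = eul (pos_part C f) + eul (null_part C f) + eul (pos_part C (- f)).
Proof.
move=> oC; have NP x : pos_part C (- f) x <-> C x /\ pairing f x < 0.
  by rewrite /pos_part pairingNl oppr_gt0.
have [[x [Cx fx]]|pos0] := pselect (exists x, pos_part C f x); last first.
  have {}pos0 x : C x -> pairing f x <= 0.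
    by move=> Cx; rewrite leNgt; apply/negP => fx; apply: pos0; exists x.
  rewrite [eul (pos_part C f)]eul0 ?add0r; last first.
    by move=> x [/pos0 + fx]; rewrite leNgt fx.
  (* A functional that is nowhere positive on a relatively open cone is negative throughout or zero
     throughout, so a single term survives. *)
  have [[y [Cy fy]]|neg0] := pselect (exists x, C x /\ pairing f x < 0).
    rewrite [eul (null_part C f)]eul0 ?add0r.
      apply: eq_eul => x; split=> [Cx|[]//]; apply/NP; split=> //.
      have [e e0 /pos0] := let: And3 _ _ CB := oC in CB x y Cx Cy.
      rewrite pairingBr pairingZr subr_le0 => /le_lt_trans; apply.
      by rewrite pmulr_rlt0.
    move=> x [Cx fx]; have [e e0 /pos0] := let: And3 _ _ CB := oC in CB x y Cx Cy.
    by rewrite pairingBr pairingZr subr_le0 fx pmulr_rge0 // leNgt fy.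
  rewrite [eul (pos_part C (- f))]eul0 ?addr0; last first.
    by move=> x /NP ?; apply: neg0; exists x.
  apply: eq_eul => x; split=> [Cx|[]//]; split=> //.
  apply: le_anti; rewrite pos0 //= leNgt; apply/negP => fx.
  by apply: neg0; exists x.
have [[y [Cy fy]]|neg0] := pselect (exists x, C x /\ pairing f x < 0); last first.
  have {}neg0 y : C y -> 0 <= pairing f y.
    by move=> Cy; rewrite leNgt; apply/negP => fy; apply: neg0; exists y.
  rewrite [eul (pos_part C (- f))]eul0 ?addr0; last first.
    by move=> y /NP[/neg0]; rewrite leNgt => /negP.
  rewrite [eul (null_part C f)]eul0 ?addr0.
    apply: eq_eul => y; split=> [Cy|[]//]; split=> //.
    have [e e0 /neg0] := let: And3 _ _ CB := oC in CB y x Cy Cx.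
    rewrite pairingBr pairingZr subr_ge0; apply: lt_le_trans.
    by rewrite mulr_gt0.
  move=> y [Cy fy]; have [e e0 /neg0] := let: And3 _ _ CB := oC in CB y x Cy Cx.
  by rewrite pairingBr pairingZr subr_ge0 fy pmulr_rle0 // leNgt fx.
have [[z Cz] dimC] := cone_dim_null_part oC Cx fx Cy fy.
rewrite (eul_neq0 Cx) (eul_neq0 Cz) (@eul_neq0 (pos_part C f) x) //.
rewrite (@eul_neq0 (pos_part C (- f)) y); last exact/NP.
rewrite /cone_dim (@lspan_pos_part C f x) // (@lspan_pos_part C (- f) y) //; last exact/NP.
by move: dimC; rewrite /cone_dim => ->; rewrite exprS mulN1r addNr add0r.
Qed.

Theorem eul_partition (I : eqType) (r : seq I) C (F : I -> set V) :
  uniq r -> rel_open C -> (forall i, i \in r -> rel_open (F i)) ->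
  (forall i j, i \in r -> j \in r -> i != j -> separated (F i) (F j)) ->
  (forall x, C x <-> exists2 i, i \in r & F i x) ->
  eul C = \sum_(i <- r) eul (F i).
Proof.
elim: {r}(size r) {-2}r (leqnn (size r)) C F => [|k IH] r szr C F ur oC oF sep CF.
  move: szr; rewrite leqn0 size_eq0 => /eqP r0; rewrite r0 big_nil eul0 //.
  by move=> x /CF[i]; rewrite r0.
case: r => [|i [|j r]] in szr ur oF sep CF *.
- by rewrite big_nil eul0 // => x /CF[i].
- rewrite big_seq1; apply: eq_eul => x; rewrite CF; split=> [[j]|Fx].
    by rewrite inE => /eqP->.
  by exists i; rewrite // mem_head.
set q := [:: i, j & r] in szr ur oF sep CF *.
have qi : i \in q by rewrite mem_head.
have qj : j \in q by rewrite inE mem_head orbT.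
have [f [fi fj fij]] : separated (F i) (F j).
  by apply: sep => //; move: ur => /= /andP[]; rewrite inE negb_or => /andP[].
clearbody q.
(* each part of the cut misses [F i] or [F j], so induction applies to it *)
have part (P : V -> Prop) l : l \in q -> (forall x, F l x -> ~ P x) ->
    rel_open (fun x => C x /\ P x) ->
    (forall i, i \in q -> rel_open (fun x => F i x /\ P x)) ->
    eul (fun x => C x /\ P x) = \sum_(i <- q) eul (fun x => F i x /\ P x).
  move=> ql Fl oCP oFP; rewrite (perm_big _ (perm_to_rem ql)) big_cons /=.
  rewrite (@eul0 (fun x => F l x /\ P x)) ?add0r; last by move=> x [Fx /(Fl x Fx)].
  apply: (IH _ _ _ (fun h x => F h x /\ P x)) => //.
  - by rewrite size_rem // -ltnS prednK //; case: (q) ql.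
  - exact: rem_uniq.
  - by move=> h /mem_rem; apply: oFP.
  - move=> g h /mem_rem qg /mem_rem qh gh.
    have [c [cg ch cgh]] := sep _ _ qg qh gh; exists c.
    split=> [x [/cg]|x [/ch]|] //.
    by case: cgh => H; [left|right] => x [/H].
  - move=> x; split=> [[/CF[h qh Fh] Px]|[h /mem_rem qh [Fh Px]]].
      exists h => //; rewrite mem_rem_uniq // inE qh andbT.
      by apply/eqP => hl; apply: (Fl x); rewrite -?hl.
    by split=> //; apply/CF; exists h.
rewrite (eul_cut f oC) (eq_big_seq _ (fun l ql => eul_cut f (oF l ql))) !big_split /=.
congr (_ + _ + _).
- apply: (part _ j) => // [x /fj||].
  + by rewrite leNgt => /negP.
  + exact: pos_part_open.
  + by move=> l ql; apply: pos_part_open; apply: oF.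
- have [pi|nj] := fij.
    apply: (part _ i) => // [x /pi /[swap] ->||].
    + by rewrite ltxx.
    + exact: null_part_open.
    + by move=> l ql; apply: null_part_open; apply: oF.
  apply: (part _ j) => // [x /nj /[swap] ->||].
  + by rewrite ltxx.
  + exact: null_part_open.
  + by move=> l ql; apply: null_part_open; apply: oF.
- apply: (part _ i) => // [x /fi||].
  + by rewrite pairingNl oppr_gt0 leNgt => /negP.
  + exact: pos_part_open.
  + by move=> l ql; apply: pos_part_open; apply: oF.
Qed.

End EulerMeasure.

(** * Rational polyhedral cones and their rays *)

Section PolyhedralCones.
Variables (R : realType) (n : nat).
Local Notation V := 'rV[R]_n.
Implicit Types (m x y z : V) (s t rho : set V).

Definition lattice_cone (gs : seq 'rV[int]_n) : set V :=
  conic (map (@of_lattice R n) gs).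

Lemma polyhedral_lattice_cone s : rational_polyhedral s ->
  exists gs, s = lattice_cone gs.
Proof.
case=> k [g ->]; exists (codom g); apply/funext => x; apply/propext; split.
  have [c0 cD cZ] := conic_convex [seq of_lattice R v | v <- codom g].
  case=> c c_ge0 ->; elim/big_ind: _ => // i _.
  by apply: (cZ) => //; apply: mem_conic; rewrite map_f ?codom_f.
move: x; apply: conic_ind.
- by exists (fun=> 0) => //; rewrite big1 // => i _; rewrite scale0r.
- move=> _ _ [c c0 ->] [d d0 ->]; exists (fun i => c i + d i).
    by move=> i; apply: addr_ge0.
  by rewrite -big_split; apply: eq_bigr => i _; rewrite scalerDl.
- move=> a _ a0 [c c0 ->]; exists (fun i => a * c i).
    by move=> i; apply: mulr_ge0.
  by rewrite scaler_sumr; apply: eq_bigr => i _; rewrite scalerA.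
- move=> _ /mapP[_ /codomP[i ->] ->]; exists (fun j => (j == i)%:R) => //.
  rewrite (bigD1 i) //= eqxx scale1r big1 ?addr0 // => j /negPf->.
  by rewrite scale0r.
Qed.

Lemma cone_of1P (v : 'rV[int]_n) x : cone_of (fun _ : 'I_1 => v) x <->
  exists2 c : R, 0 <= c & x = c *: of_lattice R v.
Proof.
split=> [[c c0 ->]|[c c0 ->]]; first by exists (c ord0); rewrite ?big_ord1.
by exists (fun=> c) => //; rewrite big_ord1.
Qed.

Lemma cone_dim_relint (gs : seq V) : cone_dim (relint (conic gs)) = cone_dim (conic gs).
Proof.
rewrite /cone_dim; congr (\dim _); apply: lspan_ext => [x []|y cy] //.
have rx := relint_conic gs; set x := \sum_(g <- gs) g in rx.
have -> : y = x + y - x by rewrite addrC addKr.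
apply: memvB; apply: mem_lspan => //; apply: relintDr => //.
exact: conic_convex.
Qed.

(* The Euler characteristic of [C `&` {m >= 0}]. *)
Definition eul_nonneg m (C : set V) := eul (pos_part C m) + eul (null_part C m).

(** By [eul_cut] this is the Euler characteristic of the relative interior minus that of the part
    where [m < 0]. That part is empty, or else has the full span, and then the two terms cancel. *)
Lemma eul_nonneg_relint m (gs : seq V) : eul_nonneg m (relint (conic gs)) =
  if `[< forall x, conic gs x -> 0 <= pairing m x >]
  then (-1) ^+ cone_dim (conic gs) else 0.
Proof.
set s := conic gs; have hs : convex_cone s := conic_convex gs.
have rx := relint_conic gs; set x := \sum_(g <- gs) g in rx.
have /(canLR (addrK _)) := eul_cut m (relint_open hs); rewrite -/(eul_nonneg m _) => <-.
rewrite (eul_neq0 rx) cone_dim_relint; case: asboolP => [ms|].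
  rewrite eul0 ?subr0 // => y [[/ms my _]].
  by rewrite pairingNl oppr_gt0 ltNge my.
move=> /existsNP[y /not_implyP[sy /negP]]; rewrite -ltNge => my.
(* Going far enough in the direction [y] brings [m] down to at most [-1]. *)
have rz : pos_part (relint s) (- m) (x + ((`|pairing m x| + 1) / - pairing m y) *: y).
  have a0 : 0 < (`|pairing m x| + 1) / - pairing m y.
    by rewrite divr_gt0 ?oppr_gt0 // ltr_wpDl.
  split; first by apply: relintDr => //; case: hs => _ _; apply => //; apply: ltW.
  rewrite !pairingE mulfVK ?oppr_eq0 ?lt_eqF //.
  by have := ler_norm (pairing m x); lra.
rewrite (eul_neq0 rz); set C := pos_part _ _ in rz *.
suff -> : cone_dim C = cone_dim (relint s) by rewrite cone_dim_relint subrr.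
by rewrite /cone_dim (lspan_pos_part (relint_open hs) rz).
Qed.

Lemma eul_nonneg_partition (I : eqType) (r : seq I) C (F : I -> set V) m :
  uniq r -> rel_open C -> (forall i, i \in r -> rel_open (F i)) ->
  (forall i j, i \in r -> j \in r -> i != j -> separated (F i) (F j)) ->
  (forall x, C x <-> exists2 i, i \in r & F i x) ->
  eul_nonneg m C = \sum_(i <- r) eul_nonneg m (F i).
Proof.
move=> ur oC oF sep CF; rewrite big_split /eul_nonneg.
have part (P : V -> Prop) : rel_open (fun x => C x /\ P x) ->
    (forall i, i \in r -> rel_open (fun x => F i x /\ P x)) ->
    eul (fun x => C x /\ P x) = \sum_(i <- r) eul (fun x => F i x /\ P x).
  move=> oCP oFP; apply: (eul_partition (F := fun i x => F i x /\ P x)) => //.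
    move=> i j ri rj ij; have [f [fi fj fij]] := sep i j ri rj ij; exists f.
    split=> [x [/fi]|x [/fj]|] //.
    by case: fij => H; [left|right] => x [/H].
  move=> x; split=> [[/CF[h rh Fh] Px]|[h rh [Fh Px]]]; first by exists h.
  by split=> //; apply/CF; exists h.
congr (_ + _); apply: part => [|i /oF].
- exact: pos_part_open.
- exact: pos_part_open.
- exact: null_part_open.
- exact: null_part_open.
Qed.

(** If no [x - e *: y] with [e > 0] lies in the cone, then [- y] is outside the cone enlarged by
    [- x]; a functional separating it is nonnegative on both [x] and [- x], hence zero at [x]. *)
Lemma conic_supporting (gs : seq V) x : conic gs x -> ~ relint (conic gs) x ->
  exists m, [/\ forall z, conic gs z -> 0 <= pairing m z, pairing m x = 0
              & exists2 y, conic gs y & 0 < pairing m y].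
Proof.
move=> sx nrx; have [_ sD sZ] := conic_convex gs.
have [y sy ny] : exists2 y, conic gs y & forall e, 0 < e -> ~ conic gs (x - e *: y).
  apply: contrapT => H; apply: nrx; split=> // y sy; apply: contrapT => Hy.
  by apply: H; exists y => // e e0 se; apply: Hy; exists e.
have [|m mK my] := @farkas_sep _ _ (- x :: gs) (- y).
  move=> /conic_cons[c c0]; rewrite scalerN opprK => cy.
  have [c1|c_le0] := ltP 0 c.
    apply: (ny c^-1); rewrite ?invr_gt0 //.
    have -> : x - c^-1 *: y = c^-1 *: (- y + c *: x).
      by rewrite scalerDr scalerN scalerA mulVf ?gt_eqF // scale1r addrC.
    by apply: sZ; rewrite // invr_ge0.
  apply: (ny 1) => //; rewrite scale1r; apply: sD => //.
  by move: cy; rewrite (@le_anti _ R c 0) ?c_le0 // scale0r addr0.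
have ms z : conic gs z -> 0 <= pairing m z.
  by move=> sz; apply: mK; apply: conic_sub sz => g ggs;
    apply: mem_conic; rewrite inE ggs orbT.
exists m; split=> //; last by exists y; rewrite // -oppr_lt0 -pairingNr.
apply: le_anti; rewrite ms // andbT -oppr_ge0 -pairingNr; apply: mK.
by apply: mem_conic; rewrite mem_head.
Qed.

(** Take the largest [k] dividing [g]; a nonzero coordinate of [g] bounds it. *)
Lemma primitive_multiple (g : 'rV[int]_n) : g != 0 ->
  exists k v, [/\ (0 < k)%N, primitive v & g = v *+ k].
Proof.
move=> g_neq0; have /existsP[i gi] : [exists i, g 0 i != 0].
  apply: contraNT g_neq0 => /existsPn g0; apply/eqP/rowP => i; rewrite mxE.
  by apply/eqP; have := g0 i; rewrite negbK.
pose P k := `[< exists w : 'rV[int]_n, g = w *+ k >].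
have exP : exists k, P k by exists 1%N; apply/asboolP; exists g.
have leP k : P k -> (k <= absz (g ord0 i))%N.
  move=> /asboolP[w gE]; apply: dvdn_leq; first by rewrite absz_gt0.
  by rewrite gE -scaler_nat mxE abszM natz absz_nat dvdn_mulr.
have [k /asboolP[v gE] kmax] := ex_maxnP exP leP.
have k0 : (0 < k)%N by rewrite lt0n; apply: contraNneq g_neq0 => k0; rewrite gE k0.
exists k, v; split=> // j w vE; apply/eqP.
have := kmax (j * k)%N; rewrite -[leqRHS]mul1n leq_pmul2r // eqn_leq => ->.
  by rewrite lt0n; apply: contraNneq g_neq0 => j0; rewrite gE vE j0 mul0rn.
by apply/asboolP; exists w; rewrite gE vE mulrnA.
Qed.

Lemma ray_gen_mem s rho : rational_polyhedral s -> is_ray s rho ->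
  s (of_lattice R (ray_gen rho)).
Proof.
move=> /polyhedral_lattice_cone[gs ->] [[m _ rhoE] _].
rewrite /ray_gen; case: xgetP => [v _ [_ rhov]|_].
  suff : rho (of_lattice R v) by rewrite rhoE => -[].
  by rewrite rhov; apply/cone_of1P; exists 1; rewrite ?scale1r.
(* The default value [0] of [ray_gen] lies in every cone. *)
by rewrite /of_lattice map_mx0; case: (conic_convex [seq of_lattice R v | v <- gs]).
Qed.

(** Both vectors generate [rho], so uniqueness of the primitive generator is avoided. *)
Lemma ray_genP rho (g : 'rV[int]_n) : g != 0 ->
  rho = cone_of (fun _ : 'I_1 => g) ->
  exists2 c : R, 0 <= c & of_lattice R g = c *: of_lattice R (ray_gen rho).
Proof.
move=> g_neq0 rhoE; have [k [v [k0 pv gE]]] := primitive_multiple g_neq0.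
have gvE : of_lattice R g = k%:R *: of_lattice R v.
  by rewrite gE scaler_nat /of_lattice raddfMn.
have kR0 : 0 < k%:R :> R by rewrite ltr0n.
have [_ rho_gen] : primitive (ray_gen rho) /\ rho = cone_of (fun _ : 'I_1 => ray_gen rho).
  apply: (@xgetPex _ _ [set v | primitive v /\ rho = cone_of (fun _ : 'I_1 => v)]%classic).
  exists v; split=> //; rewrite rhoE; apply/funext => x; apply/propext.
  split=> /cone_of1P[c c0 ->]; apply/cone_of1P.
    by exists (c * k%:R); rewrite ?mulr_ge0 ?(ltW kR0) // -scalerA gvE.
  exists (c / k%:R); first by rewrite divr_ge0 // ltW.
  by rewrite gvE scalerA mulfVK ?gt_eqF.
apply/cone_of1P; rewrite -rho_gen rhoE; apply/cone_of1P.
by exists 1; rewrite ?scale1r.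
Qed.

(* A generator that is not in the cone of the others spans a ray. *)
Lemma irredundant_ray gs g : strictly_convex (lattice_cone gs) ->
  (forall h, h \in gs -> ~ lattice_cone (rem h gs) (of_lattice R h)) ->
  g \in gs -> is_ray (lattice_cone gs) (cone_of (fun _ : 'I_1 => g)).
Proof.
move=> sconv irr gs_g; set G := of_lattice R g.
set rest := map (@of_lattice R n) (rem g gs); set s := lattice_cone gs.
have [c0 cD cZ] := conic_convex rest; have [s0 sD sZ] : convex_cone s := conic_convex _.
have sub : forall x, s x <-> conic (G :: rest) x.
  move=> x; rewrite /s /lattice_cone; split; apply: conic_sub => y.
    move=> /mapP[h h_gs ->]; apply: mem_conic.
    rewrite inE /rest -/(_ \in rest) /G; move: h_gs.
    rewrite (perm_mem (perm_to_rem gs_g)) inE => /predU1P[->|h_gs].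
      by rewrite eqxx.
    by rewrite map_f ?orbT.
  rewrite inE => /predU1P[->|/mapP[h /mem_rem h_gs ->]]; apply: mem_conic.
    exact: map_f.
  exact: map_f.
have sG : s G by apply: mem_conic; apply: map_f.
have sR x : conic rest x -> s x.
  by move=> cx; apply/sub; apply: conic_sub cx => h hr; apply: mem_conic; rewrite inE hr orbT.
have G_neq0 : G != 0.
  by apply/eqP => G0; apply: (irr g gs_g); rewrite -/G G0.
have sepE h : h \in rest -> exists m, [/\ forall x, s x -> 0 <= pairing m x,
    pairing m G = 0 & 0 < pairing m h].
  (* Listing both [G] and [- G] forces [m] to vanish on [G]. If [- h] were in this cone, then
     [(c - a) *: G = h + y] with [y] in the cone of [rest]: either [G] is redundant, or [- h] lies
     in [s] and strict convexity makes [h] a zero, hence redundant, generator. *)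
  move=> h_rest; have [|m mK mh] := @farkas_sep _ _ (- G :: G :: rest) (- h).
    move=> /conic_cons[c c_ge0 /conic_cons[a a0]].
    set y := (X in conic _ X) => cy.
    have E : (c - a) *: G = h + y.
      by rewrite /y scalerN opprK -[- h + _ - _]addrA addNKr scalerBl.
    have [ca|ca] := ltP a c.
      apply: (irr g gs_g); rewrite -/G.
      have -> : G = (c - a)^-1 *: (h + y).
        by rewrite -E scalerA mulVf ?scale1r // subr_eq0 gt_eqF.
      apply: cZ; first by rewrite invr_ge0 subr_ge0 ltW.
      by apply: cD => //; apply: mem_conic.
    have h0 : h = 0.
      apply: sconv; first by apply: sR; apply: mem_conic.
      have -> : - h = y + (a - c) *: G.
        by rewrite -(opprB c) scaleNr E opprD addrCA subrr addr0.
      by apply: sD; [exact: sR | apply: sZ; rewrite ?subr_ge0].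
    move: h_rest; rewrite h0 => /mapP[h' /mem_rem h'_gs h'0].
    apply: (irr h' h'_gs); rewrite -h'0.
    by case: (conic_convex [seq of_lattice R v | v <- rem h' gs]).
  exists m; split.
  - move=> x /sub sx; apply: mK; apply: conic_sub sx => k k_rest; apply: mem_conic.
    by rewrite inE k_rest orbT.
  - apply: le_anti; rewrite -oppr_ge0 -pairingNr.
    by rewrite !mK //; apply: mem_conic; rewrite !inE eqxx ?orbT.
  - by rewrite -oppr_lt0 -pairingNr.
have [m [ms mG m_rest]] : exists m, [/\ forall x, s x -> 0 <= pairing m x,
    pairing m G = 0 & forall h, h \in rest -> 0 < pairing m h].
  (* The functionals found for the single generators are added up. *)
  have: {subset rest <= rest} by []; elim: {1 3}rest => [_|h l IH hl].
    by exists 0; split=> // *; rewrite pairing0l.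
  have [|m [ms mG ml]] := IH; first by move=> k kl; apply: hl; rewrite inE kl orbT.
  have [|m' [m's m'G m'h]] := sepE h; first by apply: hl; rewrite mem_head.
  have srest k : k \in h :: l -> s k by move/hl/mem_conic/sR.
  exists (m + m'); split=> [x sx||k]; rewrite pairingDl.
  - by rewrite addr_ge0 ?ms ?m's.
  - by rewrite mG m'G addr0.
  - move=> kl; move: (kl); rewrite inE => /predU1P[->|/ml mk].
      by rewrite ltr_wpDl // ms //; apply: srest; rewrite mem_head.
    by rewrite ltr_pwDl // m's //; apply: srest.
(* Hence the hyperplane [m = 0] meets [s] only in the multiples of [G]. *)
have m_conic y : conic rest y -> y = 0 \/ 0 < pairing m y.
  move: y; apply: conic_ind; first by left.
  - move=> x y [->|mx] [->|my]; rewrite ?addr0 ?add0r; auto.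
    by right; rewrite pairingDr addr_gt0.
  - move=> a x; rewrite le0r => /predU1P[->|a0]; first by left; rewrite scale0r.
    by case=> [->|mx]; [left; rewrite scaler0 | right; rewrite pairingZr mulr_gt0].
  - by move=> h /m_rest; right.
split.
  exists m => //; apply/funext => x; apply/propext; split.
    move=> /cone_of1P[c c_ge0 ->]; split; first exact: sZ.
    by rewrite pairingZr mG mulr0.
  case=> /sub/conic_cons[c c_ge0 cx] mx; apply/cone_of1P; exists c => //.
  apply/eqP; rewrite -subr_eq0; apply/eqP; case: (m_conic _ cx) => // .
  by rewrite pairingBr pairingZr mx mG mulr0 subrr ltxx.
rewrite /cone_dim; have -> : lspan (cone_of (fun _ : 'I_1 => g)) = <[G]>%VS.
  apply/eqP; rewrite eqEsubv; apply/andP; split.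
    by apply: lspan_sub => x /cone_of1P[c _ ->]; apply/memvZ/memv_line.
  by rewrite -memvE; apply: mem_lspan; apply/cone_of1P; exists 1; rewrite ?scale1r.
by rewrite dim_vline G_neq0.
Qed.

(** In a generating list of minimal length no generator is redundant, so each one spans a ray and is
    a nonnegative multiple of its [ray_gen]. *)
Lemma rays_nonneg s m : rational_polyhedral s -> strictly_convex s ->
  (forall rho, is_ray s rho -> 0 <= pairing m (of_lattice R (ray_gen rho))) <->
  (forall x, s x -> 0 <= pairing m x).
Proof.
move=> ps sconv; split=> [m_rays|ms rho /ray_gen_mem sr]; last exact/ms/sr.
pose P k := `[< exists gs, s = lattice_cone gs /\ size gs = k >].
have exP : exists k, P k.
  by have [gs sE] := polyhedral_lattice_cone ps; exists (size gs); apply/asboolP; exists gs.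
case: (ex_minnP exP) => k /asboolP[gs [sE szgs]] kmin; rewrite sE in m_rays sconv *.
have irr h : h \in gs -> ~ lattice_cone (rem h gs) (of_lattice R h).
  move=> gs_h ch; suff /kmin : P (size (rem h gs)).
    by rewrite size_rem // -szgs; case: (gs) gs_h => //= a l _; rewrite ltnn.
  apply/asboolP; exists (rem h gs); split=> //; rewrite sE.
  apply/funext => x; apply/propext; split; apply: conic_sub => _ /mapP[g + ->].
    rewrite (perm_mem (perm_to_rem gs_h)) inE => /predU1P[->//|g_gs].
    by apply: mem_conic; apply: map_f.
  by move=> /mem_rem g_gs; apply: mem_conic; apply: map_f.
apply: conic_halfspace => _ /mapP[g g_gs ->].
have g_neq0 : g != 0.
  apply/eqP => g0; apply: (irr g g_gs); rewrite g0 /of_lattice map_mx0.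
  by case: (conic_convex [seq of_lattice R v | v <- rem 0 gs]).
have [c c0 ->] := ray_genP g_neq0 erefl.
by rewrite pairingZr mulr_ge0 // m_rays //; apply: irredundant_ray.
Qed.

End PolyhedralCones.

(** * Fans and refinements *)

Section FanRelints.
Variables (R : realType) (n : nat).
Local Notation V := 'rV[R]_n.
Implicit Types (m x y z : V) (s t : set V) (S : fan R n).

Lemma fan_conic S s : s \in cones S -> exists gs : seq V, s = conic gs.
Proof.
move=> /fan_polyhedral/polyhedral_lattice_cone[gs ->].
by exists (map (@of_lattice R n) gs).
Qed.

Lemma fan_convex S s : s \in cones S -> convex_cone s.
Proof. by case/fan_conic=> gs ->; apply: conic_convex. Qed.

(** The functional cutting out the face [s] meet [t] of [s] vanishes at the relative interior point
    [x], hence on all of [s]. *)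
Lemma fan_relint_sub S s t x : s \in cones S -> t \in cones S ->
  relint s x -> t x -> forall y, s y -> t y.
Proof.
move=> sS tS rx tx y sy; have [[m ms stE] _] := fan_meet sS tS.
suff : (s `&` t)%classic y by case.
have : (s `&` t)%classic x by split; [case: rx|].
rewrite stE => -[_ mx]; split=> //; apply: contrapT => /eqP my.
by have := relint_pairing_gt0 ms rx sy my; rewrite mx ltxx.
Qed.

Lemma fan_relint_inj S s t x : s \in cones S -> t \in cones S ->
  relint s x -> relint t x -> s = t.
Proof.
move=> sS tS rs rt; apply/funext => y; apply/propext.
by split; [apply: (fan_relint_sub sS tS rs rt.1)|apply: (fan_relint_sub tS sS rt rs.1)].
Qed.

Lemma fan_relint_separated S s t : s \in cones S -> t \in cones S -> s != t ->
  separated (relint s) (relint t).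
Proof.
move=> sS tS /eqP st; have [gs sE] := fan_conic sS; have [hs tE] := fan_conic tS.
rewrite sE tE; apply: relint_separated => x; rewrite -sE -tE => rs rt.
exact/st/(fan_relint_inj sS tS rs rt).
Qed.

(* A cone of minimal dimension containing [x] has [x] in its relative interior:
   otherwise some supporting hyperplane through [x] cuts out a smaller face. *)
Lemma fan_relint_cover S x : Defs.support S x ->
  exists2 s, s \in cones S & relint s x.
Proof.
pose P d := `[< exists s, [/\ s \in cones S, s x & cone_dim s = d] >].
move=> [s0 s0S s0x]; have exP : exists d, P d.
  by exists (cone_dim s0); apply/asboolP; exists s0.
case: (ex_minnP exP) => d /asboolP[s [sS sx sd]] dmin; exists s => //.
apply: contrapT => nrx; have [gs sE] := fan_conic sS.
rewrite sE in nrx sx; have [m [ms mx [y sy my]]] := conic_supporting sx nrx.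
rewrite -sE in ms sx sy; set t : set V := [set z | s z /\ pairing m z = 0]%classic.
have tS : t \in cones S by apply: fan_face sS _; exists m.
have /dmin : P (cone_dim t) by apply/asboolP; exists t.
rewrite -sd leqNgt => /negP; apply.
have sub : (lspan t <= lspan s)%VS.
  by apply: lspan_sub => z [sz _]; apply: mem_lspan.
rewrite /cone_dim ltn_neqAle dimvS // andbT; apply: contraL my => /eqP dimE.
have {}dimE : lspan t = lspan s by apply/eqP; rewrite eqEdim sub dimE leqnn.
rewrite -leNgt (@lspan_kernel _ _ t 0%VS) // => [z []//|].
by rewrite dimE mem_lspan.
Qed.

(** Some cone [t] of [S] contains [s']; the functional cutting out the face [s] meet [t] of [t]
    vanishes at [x], hence on [s']. For the second inclusion, a point of [relint s'] is a small
    multiple of [x] plus a point of [s]. *)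
Lemma refines_relint S S' s s' x : refines S' S -> s \in cones S -> s' \in cones S' ->
  relint s x -> relint s' x -> (s' `<=` s)%classic /\ (relint s' `<=` relint s)%classic.
Proof.
move=> [_ ref] sS s'S' rx rx'; have [t tS s't] := ref s' s'S'.
have s's : (s' `<=` s)%classic.
  have st := fan_relint_sub sS tS rx (s't x rx'.1).
  have [[_ _ _] [m mt stE]] := fan_meet sS tS.
  move=> y s'y; suff : (s `&` t)%classic y by case.
  have : (s `&` t)%classic x by split; [case: rx|apply: s't; case: rx'].
  rewrite stE => -[tx mx]; split; first exact: s't.
  apply: contrapT => /eqP my.
  have /relint_pairing_gt0 : forall z, s' z -> 0 <= pairing m z by move=> z /s't/mt.
  by move=> /(_ _ _ rx' s'y my); rewrite mx ltxx.
split=> // z rz; have [e e0 s'z] := rz.2 x rx'.1.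
have -> : z = e *: x + (z - e *: x) by rewrite addrC subrK.
have hs := fan_convex sS.
by apply: relintDr; [| apply: relintZ | apply: s's].
Qed.

(** Selecting by relative interiors rather than by inclusion puts each cone of a refinement into
    exactly one such list. *)
Definition refining_cones S s : seq (set V) :=
  [seq s' <- cones S | `[< forall x, relint s' x -> relint s x >]].

Lemma refines_relint_eul S S' s m : refines S' S -> s \in cones S ->
  eul_nonneg m (relint s) =
  \sum_(s' <- refining_cones S' s) eul_nonneg m (relint s').
Proof.
move=> ref sS; have memr s' : s' \in refining_cones S' s ->
    s' \in cones S' /\ forall x, relint s' x -> relint s x.
  by rewrite mem_filter => /andP[/asboolP].
apply: eul_nonneg_partition.
- by rewrite filter_uniq // fset_uniq.
- exact/relint_open/(fan_convex sS).
- by move=> s' /memr[s'S' _]; apply/relint_open/(fan_convex s'S').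
- by move=> s' t' /memr[s'S' _] /memr[t'S' _]; apply: (fan_relint_separated s'S' t'S').
- move=> x; split=> [rx|[s' /memr[_ sub] /sub]//].
  have : Defs.support S' x by rewrite ref.1; exists s => //; case: rx.
  move=> /fan_relint_cover[s' s'S' rx']; exists s' => //.
  rewrite mem_filter s'S' andbT; apply/asboolP.
  exact: (refines_relint ref sS s'S' rx rx').2.
Qed.

Lemma refines_sum S S' (A : nmodType) (F : set V -> A) : refines S' S ->
  \sum_(s' <- cones S') F s' = \sum_(s <- cones S) \sum_(s' <- refining_cones S' s) F s'.
Proof.
move=> ref; under [RHS]eq_bigr do rewrite big_filter.
rewrite (exchange_big_dep xpredT) //= big_seq [RHS]big_seq; apply: eq_bigr => s' s'S'.
have [gs s'E] := fan_conic s'S'; have := relint_conic gs; rewrite -s'E.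
set x := \sum_(g <- gs) g => rx'.
have [s sS rx] : exists2 s, s \in cones S & relint s x.
  by apply: fan_relint_cover; rewrite -ref.1; exists s' => //; case: rx'.
(* After the exchange of sums, the only index left for [s'] is the cone of [S] whose relative
   interior contains the chosen point [x]. *)
rewrite -big_filter (_ : [seq _ <- _ | _] = [:: s]) ?big_seq1 //.
rewrite -(filter_pred1_uniq (fset_uniq (cones S)) sS); apply: eq_in_filter => t tS /=.
apply/asboolP/eqP => [/(_ x rx') rt|->]; first exact: (fan_relint_inj tS sS rt rx).
exact: (refines_relint ref sS s'S' rx rx').2.
Qed.

End FanRelints.

(** * Spans of subsets of a matroid basis *)

Section MatroidSpan.
Variables (G : finType) (M : matroid G).
Implicit Types (A B I : {set G}) (x : G).

Lemma mrank_indep A : indep M A -> mrank M A = #|A|.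
Proof.
move=> iA; apply/eqP; rewrite eqn_leq; apply/andP; split.
  by apply/bigop.bigmax_leqP => I /andP[_]; apply: subset_leq_card.
by apply: (bigop.bigmax_sup A); rewrite ?iA ?subxx.
Qed.

Lemma mem_mspan_indep A x : indep M A ->
  (x \in mspan M A) = (x \in A) || ~~ indep M (x |: A).
Proof.
move=> iA; rewrite inE; have [xA|xNA] /= := boolP (x \in A).
  by rewrite (finset.setUidPr _) ?eqxx // finset.sub1set.
have [ixA|nixA] /= := boolP (indep M (x |: A)).
  by rewrite !mrank_indep // cardsU1 xNA -[eqbRHS]add0n eqn_add2r.
rewrite eqn_leq; apply/andP; split; last first.
  rewrite (mrank_indep iA); apply: (bigop.bigmax_sup A) => //.
  by rewrite iA finset.subsetUr.
apply/bigop.bigmax_leqP => I /andP[iI sI]; rewrite mrank_indep // leqNgt.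
apply/negP => cI; move/negP: nixA; apply; suff <- : I = x |: A by [].
by apply/eqP; rewrite eqEcard sI cardsU1 xNA add1n.
Qed.

(** A larger independent subset of the span would augment [A] by an element of its span. *)
Lemma mrank_mspan_indep A : indep M A -> mrank M (mspan M A) = #|A|.
Proof.
move=> iA; apply/eqP; rewrite eqn_leq; apply/andP; split; last first.
  apply: (bigop.bigmax_sup A) => //; rewrite iA /=; apply/fintype.subsetP => x xA.
  by rewrite mem_mspan_indep // xA.
apply/bigop.bigmax_leqP => I /andP[iI sI]; rewrite leqNgt; apply/negP.
move=> /(indep_augment iA iI)[x]; rewrite inE => /andP[xNA /(fintype.subsetP sI)].
by rewrite mem_mspan_indep // (negPf xNA) => /negP.
Qed.

Lemma basis_indep B A : is_basis M B -> A \subset B -> indep M A.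
Proof. by move=> /maxsetp iB AB; apply: indepS iB. Qed.

Lemma mem_mspan_sub_basis A B x : is_basis M B -> A \subset B ->
  (x \in mspan M A) = (x \in A) || ~~ indep M (x |: A).
Proof. by move=> bB AB; rewrite mem_mspan_indep ?(basis_indep bB AB). Qed.

Lemma mspan_basis B x : is_basis M B -> x \in mspan M B.
Proof.
move=> bB; rewrite (mem_mspan_sub_basis _ bB) //.
have [ixB|_] := boolP (indep M (x |: B)); last by rewrite orbT.
have /maxsetP[_ /(_ _ ixB (finset.subsetUr _ _)) E] := bB.
by rewrite -E finset.setU11.
Qed.

Lemma indep_extend A B : indep M A -> indep M B ->
  exists I, [/\ A \subset I, I \subset A :|: B, indep M I & (#|B| <= #|I|)%N].
Proof.
move=> iA iB; pose P I := [&& A \subset I, I \subset A :|: B & indep M I].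
have PA : P A by rewrite /P subxx finset.subsetUl.
case: (@arg_maxnP _ A P (fun I : {set G} => #|I|) PA) => I /and3P[AI IAB iI] Imax.
exists I; split=> //; rewrite leqNgt; apply/negP => /(indep_augment iI iB)[x].
rewrite inE => /andP[xNI xB] ixI.
have /Imax : P (x |: I).
  by rewrite /P ixI andbT (fintype.subset_trans AI) ?finset.subsetUr // finset.subUset IAB
    finset.sub1set inE xB orbT.
by rewrite cardsU1 xNI /= add1n ltnn.
Qed.

(* For [x] outside the basis, the least [A] spanning [x] is the fundamental
   circuit of [x] minus [x], so it is contained in every spanning subset. *)
Lemma mspan_least B x : is_basis M B -> x \notin B ->
  exists2 A : {set G}, A \subset B /\ x \in mspan M A &
    forall A' : {set G}, A' \subset B -> x \in mspan M A' -> A \subset A'.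
Proof.
move=> bB xNB; pose P (A : {set G}) := (A \subset B) && (x \in mspan M A).
have PB : P B by rewrite /P subxx mspan_basis.
case: (@arg_minnP _ B P (fun A : {set G} => #|A|) PB) => A /andP[AB xA] Amin.
exists A => // A' A'B xA'; apply/fintype.subsetP => a aA; apply: contraT => aNA'.
have notin (C : {set G}) : C \subset B -> x \notin C.
  by move=> CB; apply/negP => /(fintype.subsetP CB); apply/negP.
have dep (C : {set G}) : C \subset B -> (x \in mspan M C) = ~~ indep M (x |: C).
  by move=> CB; rewrite (mem_mspan_sub_basis _ bB) // (negPf (notin C CB)).
have AaB : A :\ a \subset B := fintype.subset_trans (finset.subsetDl _ _) AB.
have ixAa : indep M (x |: A :\ a).
  apply: contraT; rewrite -dep // => xAa.
  have /Amin : P (A :\ a) by rewrite /P AaB.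
  by rewrite (cardsD1 a A) aA add1n ltnn.
(* Basis exchange: [I] cannot contain [a], since it would then contain the dependent set [x |: A];
   by cardinality it is [x |: B :\ a]. A spanning [A'] without [a] would make this set dependent. *)
have [I [AI IAB iI cI]] := indep_extend ixAa (maxsetp bB).
have aNI : a \notin I.
  apply/negP => aI; move: xA; rewrite dep // => /negP; apply; apply: indepS iI.
  rewrite finset.subUset; move: AI; rewrite finset.subUset => /andP[-> AaI] /=.
  by rewrite -(finset.setD1K aA) finset.subUset finset.sub1set aI.
have IE : I = x |: B :\ a.
  apply/eqP; rewrite eqEcard cardsU1 !inE (negPf xNB) andbF /=.
  have aB := fintype.subsetP AB a aA; rewrite add1n.
  rewrite (cardsD1 a B) aB add1n in cI; rewrite cI andbT.
  apply/fintype.subsetP => z zI; have za : z != a by apply: contraNneq aNI => <-.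
  have := fintype.subsetP IAB z zI; rewrite !inE za /=.
  by move=> /orP[/orP[->//|/(fintype.subsetP AB)->]|->]; rewrite orbT.
have A'Ba : A' \subset B :\ a by rewrite finset.subsetD1 A'B.
move: xA'; rewrite dep // => /negP[]; apply: indepS iI; rewrite IE.
exact: finset.setUS.
Qed.

(** An element of [B] is spanned only by the subsets containing it; for any other [x] the least
    spanning subset lies in every [A]. The empty family, which the zero cone produces, gives the
    span of [B]. *)
Lemma mspan_bigcap B (P : {set G} -> Prop) x : is_basis M B ->
  (forall A, P A -> A \subset B) ->
  (forall A, P A -> x \in mspan M A) <->
  x \in mspan M [set b in B | `[< forall A, P A -> b \in A >]]%SET.
Proof.
move=> bB PB; set D := [set b in B | _]%SET.
have DB : D \subset B by apply/fintype.subsetP => b; rewrite inE => /andP[].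
have memP b : b \in B -> (forall A, P A -> b \in A) -> b \in D.
  by move=> bb bP; rewrite inE bb; apply/asboolP.
have DP A : P A -> D \subset A.
  by move=> PA; apply/fintype.subsetP => b; rewrite inE => /andP[_ /asboolP]; apply.
have mono (C C' : {set G}) : C \subset C' -> C' \subset B -> x \in mspan M C -> x \in mspan M C'.
  move=> CC' C'B; rewrite !(mem_mspan_sub_basis _ bB) ?(fintype.subset_trans CC') //.
  move=> /orP[/(fintype.subsetP CC')->//|nC]; apply/orP; right; apply: contra nC.
  by apply: indepS; apply: finset.setUS.
split=> [xP|xD A PA]; last by apply: mono xD; [exact: DP|exact: PB].
have [xB|xNB] := boolP (x \in B).
  rewrite (mem_mspan_sub_basis _ bB) // memP // => A PA.
  have := xP A PA; rewrite (mem_mspan_sub_basis _ bB (PB A PA)).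
  case/orP=> // /negP[]; apply: (basis_indep bB).
  by rewrite finset.subUset finset.sub1set xB PB.
have [A [AB xA] Amin] := mspan_least bB xNB; apply: mono xA => //.
apply/fintype.subsetP => b bA; apply: memP; first exact: (fintype.subsetP AB).
by move=> C PC; apply: (fintype.subsetP (Amin C (PB C PC) (xP C PC))).
Qed.

End MatroidSpan.

(** * The Euler characteristic of a tropical vector bundle *)

Section Sections.
Variables (R : realType) (n : nat) (G : finType) (M : matroid G).
Local Notation V := 'rV[R]_n.
Implicit Types (S : fan R n) (s : set V) (u : 'rV[int]_n) (B : {set G}).

Lemma mrank_H0 S (E : tropical_bundle M S) s B ch u :
  s \in cones S -> splits M (filt E) s B ch ->
  mrank M (H0 E s u) = #|[set b in B |
    `[< forall x, s x -> 0 <= pairing (of_lattice R (ch b - u)) x >]]%SET|.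
Proof.
move=> sS [bB split_s]; set D := [set b in B | _]%SET.
pose F (rho : set V) := [set b in B | pairing u (ray_gen rho) <= pairing (ch b) (ray_gen rho)]%SET.
pose P A := exists2 rho, is_ray s rho & A = F rho.
(* Nonnegativity on [s] is tested at the ray generators, so [D] is the intersection in [B] of the
   sets [F rho]. *)
have DE : D = [set b in B | `[< forall A, P A -> b \in A >]]%SET.
  apply/finset.setP => b; rewrite !inE; case: (boolP (b \in B)) => //= bb.
  apply: asbool_equiv_eq; rewrite -rays_nonneg; first last.
  - exact: fan_strictly_convex sS.
  - exact: fan_polyhedral sS.
  split=> [ge0 A [rho srho ->]|memF rho srho].
    by have := ge0 rho srho; rewrite pairing_of_lattice ler0z pairingBl subr_ge0 inE bb.
  rewrite pairing_of_lattice ler0z pairingBl subr_ge0.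
  by have := memF (F rho) (ex_intro2 _ _ rho srho erefl); rewrite inE bb.
have DB : D \subset B by apply/fintype.subsetP => b; rewrite inE => /andP[].
rewrite -(mrank_mspan_indep (basis_indep bB DB)); congr mrank.
apply/finset.setP => g; rewrite inE; apply/asboolP/idP.
  move=> gF; rewrite DE; apply/mspan_bigcap => //.
    by move=> A [rho _ ->]; apply/fintype.subsetP => b; rewrite inE => /andP[].
  by move=> A [rho srho ->]; rewrite -split_s //; apply: gF.
rewrite DE => /mspan_bigcap gP rho srho; rewrite split_s //; apply: gP => //.
  by move=> A [rho' _ ->]; apply/fintype.subsetP => b; rewrite inE => /andP[].
by exists rho.
Qed.

Lemma euler_char_term S (E : tropical_bundle M S) s B ch u :
  s \in cones S -> splits M (filt E) s B ch ->
  (-1) ^+ (n - cone_dim s) * (mrank M (H0 E s u))%:Z =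
  (-1) ^+ n * \sum_(b in B) eul_nonneg (of_lattice R (ch b - u)) (relint s).
Proof.
(* This bound makes the natural number subtraction exact, so the sign splits as [(-1) ^+ n] times
   [(-1) ^+ cone_dim s]. *)
move=> sS spl; have dim_le : (cone_dim s <= n)%N.
  by rewrite /cone_dim (leq_trans (dimvS (subvf _))) // dimvf /dim /= mul1n.
rewrite (mrank_H0 u sS spl) -signr_odd oddB // signr_addb !signr_odd -mulrA.
congr (_ * _); have [gs sE] := fan_conic sS.
rewrite -sum1_card (big_morph Posz PoszD (erefl 0%:Z)) mulr_sumr.
under eq_bigl do rewrite inE; rewrite big_mkcondr; apply: eq_bigr => b _.
by rewrite sE eul_nonneg_relint mulr1.
Qed.

End Sections.

Theorem theorem1p2 (R : realType) (n : nat) (G : finType) (M : matroid G)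
    (Sigma Sigma' : fan R n)
    (Sigma_complete : complete_fan Sigma)
    (Sigma'_refines : refines Sigma' Sigma)
    (E : tropical_bundle M Sigma) (E' : tropical_bundle M Sigma')
    (E'_pullback : is_pullback E E')
    (u : 'rV[int]_n) :
  euler_char E u = euler_char E' u.
Proof.
have [B [ch [splitE splitE']]] := E'_pullback.
(* Grouping the cones of [Sigma'] by the cone of [Sigma] whose relative interior contains theirs
   reduces the claim to one [s] at a time. *)
rewrite /euler_char (refines_sum _ Sigma'_refines) big_seq [RHS]big_seq.
apply: eq_bigr => s sS; rewrite (euler_char_term u sS (splitE s sS)).
have termE' s' : s' \in refining_cones Sigma' s ->
    (-1) ^+ (n - cone_dim s') * (mrank M (H0 E' s' u))%:Z =
    (-1) ^+ n * \sum_(b in B s) eul_nonneg (of_lattice R (ch s b - u)) (relint s').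
  rewrite mem_filter => /andP[/asboolP sub s'S'].
  (* Since [s'] is contained in [s], the pull-back splits on it with the basis and characters of
     [s]. *)
  apply: euler_char_term => //; apply: splitE' => //.
  have [gs s'E] := fan_conic s'S'; have := relint_conic gs; rewrite -s'E => rx.
  by have [] := refines_relint Sigma'_refines sS s'S' (sub _ rx) rx.
rewrite (eq_big_seq _ termE') -mulr_sumr exchange_big /=; congr (_ * _).
by apply: eq_bigr => b _; apply: (refines_relint_eul _ Sigma'_refines sS).
Qed.
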